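(* Let $M$ be a space form of constant curvature $K$, let $I\subset\mathbb{R}$ be an interval, let $r\in\{3,4\}$, and let $\gamma\colon I\to M$ be a proper $r$-harmonic curve parametrized by arclength whose geodesic curvatures $k_i$, $i=1,\ldots,2r-2$, are all constant. (1) If $r=3$, the geodesic curvatures $k_j$, $j=1,\ldots,4$, satisfy \begin{align*} (k_1^2+k_2^2)^2+k_2^2k_3^2&=K(2k_1^2+k_2^2),\\ k_2k_3\big(k_1^2+k_2^2+k_3^2+k_4^2\big)&=k_2k_3K. \end{align*} (2) If $r=4$, the geodesic curvatures $k_j$, $j=1,\ldots,6$, satisfy \begin{align*} (k_1^2+k_2^2)^3+k_2^2k_3^2(2k_1^2+2k_2^2+k_3^2+k_4^2)&=K\big((k_1^2+k_2^2)^2+k_2^2k_3^2\big)+2Kk_1^2(k_1^2+k_2^2),\\ k_2k_3\big((k_1^2+k_2^2)^2+(k_3^2+k_4^2)^2+k_1^2k_3^2+2k_2^2k_3^2+k_4^2(k_1^2+k_2^2+k_5^2)\big)&=k_2k_3K(2k_1^2+k_2^2+k_3^2+k_4^2),\\ k_2k_3k_4k_5\big(k_1^2+k_2^2+k_3^2+k_4^2+k_5^2+k_6^2\big)&=k_2k_3k_4k_5K. \end{align*}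
   Context: In a space form of constant curvature $K$ the curvature tensor is $R(X,Y)Z=K(\langle Y,Z\rangle X-\langle X,Z\rangle Y)$. Let $T=\gamma'$ and let $\nabla_T$ be covariant differentiation along $\gamma$ for the Levi-Civita connection. A curve $\gamma\colon I\to M$ is called $r$-harmonic ($r\ge2$) if it is a critical point of $E_r(\gamma)=\frac12\int_I|\nabla_T^{r-1}T|^2\,ds$, equivalently (in a space form) if $$0=\nabla_T^{2r-1}T+K\sum_{l=0}^{r-2}(-1)^l\big(\langle T,\nabla_T^lT\rangle\nabla_T^{2r-3-l}T-\langle T,\nabla_T^{2r-3-l}T\rangle\nabla_T^lT\big).$$ A geodesic is a curve with $\nabla_TT=0$; an $r$-harmonic curve is called proper if it is not a geodesic. Frenet frame and geodesic curvatures: for a curve parametrized by arclength ($|\gamma'|=1$) in an $n$-dimensional manifold, the Frenet frame is an orthonormal frame $F_1,\ldots,F_n$ along $\gamma$ with $$F_1=T,\quad \nabla_TF_1=k_1F_2,\quad \nabla_TF_i=-k_{i-1}F_{i-1}+k_iF_{i+1}\ (i=2,\ldots,n-1),\quad \nabla_TF_n=-k_{n-1}F_{n-1},$$ and $k_1,\ldots,k_{n-1}$ are the geodesic curvatures of $\gamma$. Curvatures $k_j$ with $j\geq n$ are understood to be $0$. *)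

(* Defs.v *)
From HB Require Import structures.
From mathcomp Require Import all_boot all_order all_algebra.
From mathcomp Require Import all_classical all_reals all_analysis.

Set Implicit Arguments.
Unset Strict Implicit.
Unset Printing Implicit Defensive.

Import Order.TTheory GRing.Theory Num.Theory.
Import numFieldNormedType.Exports.

Local Open Scope classical_set_scope.
Local Open Scope ring_scope.

Definition partial (R : realType) (n : nat) (V : normedModType R) (i : 'I_n)
    (f : 'rV[R]_n -> V) : 'rV[R]_n -> V :=
  'D_(delta_mx 0 i) f.

Fixpoint Ck (R : realType) (n : nat) (V : normedModType R) (k : nat)
    (U : set 'rV[R]_n) (f : 'rV[R]_n -> V) : Prop :=
  match k with
  | 0%N => forall x, U x -> {for x, continuous f}
  | k'.+1 => forall i : 'I_n,
      (forall x, U x -> derivable f x (delta_mx 0 i)) /\ Ck k' U (partial i f)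
  end.

Definition smooth (R : realType) (n : nat) (V : normedModType R)
    (U : set 'rV[R]_n) (f : 'rV[R]_n -> V) : Prop :=
  forall k, Ck k U f.

(* Smooth n-manifolds given by an atlas.  [chart_map c] and [chart_inv c] are
   total functions, meaningful only on [chart_dom c] and on its image. *)
Record manifold (R : realType) (n : nat) := Manifold {
  carrier :> topologicalType;
  manifold_hausdorff : hausdorff_space carrier;
  manifold_second_countable : @second_countable carrier;
  chart : Type;
  chart_dom : chart -> set carrier;
  chart_map : chart -> carrier -> 'rV[R]_n;
  chart_inv : chart -> 'rV[R]_n -> carrier;
  chart_dom_cover : forall p, exists c, chart_dom c p;
  chart_dom_open : forall c, open (chart_dom c);
  chart_image_open : forall c, open (chart_map c @` chart_dom c);
  chart_mapK : forall c p, chart_dom c p -> chart_inv c (chart_map c p) = p;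
  chart_map_continuous : forall c p, chart_dom c p ->
    {for p, continuous (chart_map c)};
  chart_inv_continuous : forall c p, chart_dom c p ->
    {for chart_map c p, continuous (chart_inv c)};
  transition_smooth : forall c c',
    smooth (chart_map c @` (chart_dom c `&` chart_dom c'))
      (chart_map c' \o chart_inv c) }.

Definition transition (R : realType) (n : nat) (M : manifold R n)
    (c c' : chart M) : 'rV[R]_n -> 'rV[R]_n :=
  chart_map c' \o chart_inv c.

(* A tangent vector at p is represented by its components [v c : 'rV_n] in the
   charts c around p; they transform by v c' = v c *m J, where J is the jacobian
   of the transition map (row-vector convention of MathComp's [jacobian]). *)
Definition transition_jacobian (R : realType) (n : nat) (M : manifold R n)
    (c c' : chart M) (p : M) : 'M[R]_n :=
  jacobian (transition c c') (chart_map c p).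

Record riemannian (R : realType) (n : nat) := Riemannian {
  base :> manifold R n;
  metric : chart base -> 'rV[R]_n -> 'M[R]_n;
  metric_smooth : forall c i j,
    smooth (chart_map c @` chart_dom c) (fun x => metric c x i j : R^o);
  metric_sym : forall c p, chart_dom c p ->
    (metric c (chart_map c p))^T = metric c (chart_map c p);
  metric_pos : forall c p, chart_dom c p -> forall v : 'rV[R]_n, v != 0 ->
    0 < (v *m metric c (chart_map c p) *m v^T) 0 0;
  metric_change : forall c c' p, chart_dom c p -> chart_dom c' p ->
    metric c (chart_map c p) =
      transition_jacobian c c' p *m metric c' (chart_map c' p)
        *m (transition_jacobian c c' p)^T }.

Definition inner (R : realType) (n : nat) (M : riemannian R n) (c : chart M)
    (x v w : 'rV[R]_n) : R :=
  (v *m metric c x *m w^T) 0 0.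

(* [christoffel c l i j] is the Christoffel symbol of the Levi-Civita
   connection with upper index l and lower indices i, j. *)
Definition christoffel (R : realType) (n : nat) (M : riemannian R n)
    (c : chart M) (l i j : 'I_n) (x : 'rV[R]_n) : R :=
  let g a b := (fun y => metric c y a b : R^o) in
  2^-1 * \sum_(m < n) invmx (metric c x) l m *
    (partial i (g j m) x + partial j (g i m) x - partial m (g i j) x).

(* The l-th component of R(e_i, e_j) e_k for the coordinate fields e_i, with
   R(X, Y) Z = D_X D_Y Z - D_Y D_X Z - D_[X, Y] Z. *)
Definition curvature_coef (R : realType) (n : nat) (M : riemannian R n)
    (c : chart M) (l i j k : 'I_n) (x : 'rV[R]_n) : R :=
  let G a b d := (fun y => christoffel c a b d y : R^o) in
  partial i (G l j k) x - partial j (G l i k) x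
  + \sum_(m < n) (G l i m x * G m j k x - G l j m x * G m i k x).

Definition curvature (R : realType) (n : nat) (M : riemannian R n)
    (c : chart M) (x X Y Z : 'rV[R]_n) : 'rV[R]_n :=
  \row_l \sum_(i < n) \sum_(j < n) \sum_(k < n)
    X 0 i * Y 0 j * Z 0 k * curvature_coef c l i j k x.

Definition space_form (R : realType) (n : nat) (M : riemannian R n)
    (K : R) : Prop :=
  forall (c : chart M) (p : M), chart_dom c p -> forall X Y Z : 'rV[R]_n,
    let x := chart_map c p in
    curvature c x X Y Z =
      K *: (inner c x Y Z *: X - inner c x X Z *: Y).

Definition nondegenerate_interval (R : realType) (I : set R) : Prop :=
  is_interval I /\ exists a b, [/\ I a, I b & a < b].

(* Derivative of the restriction of f to I: one-sided at the endpoints that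
   belong to I. *)
Definition quotient_within (R : realType) (V : normedModType R)
    (f : R -> V) (s : R) : R -> V :=
  fun t => (t - s)^-1 *: (f t - f s).

Definition derivable_within (R : realType) (V : normedModType R) (I : set R)
    (f : R -> V) (s : R) : Prop :=
  cvg (quotient_within f s @ within I (dnbhs s)).

Definition derive_within (R : realType) (V : normedModType R) (I : set R)
    (f : R -> V) : R -> V :=
  fun s => lim (quotient_within f s @ within I (dnbhs s)).

(* Smoothness, as functions on I, at all the points of a relatively open
   subset J of I. *)
Definition smooth_within (R : realType) (V : normedModType R) (I J : set R)
    (f : R -> V) : Prop :=
  forall k s, J s -> derivable_within I (iter k (derive_within I) f) s.

Definition in_chart (R : realType) (n : nat) (M : manifold R n)
    (gamma : R -> M) (I : set R) (c : chart M) : set R :=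
  I `&` gamma @^-1` chart_dom c.

Definition smooth_curve (R : realType) (n : nat) (M : manifold R n)
    (I : set R) (gamma : R -> M) : Prop :=
  {within I, continuous gamma} /\
  forall c, smooth_within I (in_chart gamma I c) (chart_map c \o gamma).

(* A vector field along gamma : [V c s] is the row of components of V(s) in the
   chart c, meaningful when gamma s belongs to [chart_dom c]. *)
Definition field_along (R : realType) (n : nat) (M : manifold R n) :=
  chart M -> R -> 'rV[R]_n.

Definition smooth_field (R : realType) (n : nat) (M : manifold R n)
    (I : set R) (gamma : R -> M) (V : field_along M) : Prop :=
  (forall c, smooth_within I (in_chart gamma I c) (V c)) /\
  (forall c c' s, in_chart gamma I c s -> in_chart gamma I c' s ->
     V c' s = V c s *m transition_jacobian c c' (gamma s)).

Definition velocity (R : realType) (n : nat) (M : manifold R n)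
    (I : set R) (gamma : R -> M) : field_along M :=
  fun c => derive_within I (chart_map c \o gamma).

Definition inner_along (R : realType) (n : nat) (M : riemannian R n)
    (gamma : R -> M) (V W : field_along M) (c : chart M) (s : R) : R :=
  inner c (chart_map c (gamma s)) (V c s) (W c s).

(* Covariant derivative of V along gamma for the Levi-Civita connection. *)
Definition cov_derive (R : realType) (n : nat) (M : riemannian R n)
    (I : set R) (gamma : R -> M) (V : field_along M) : field_along M :=
  fun c s => derive_within I (V c) s +
    \row_l \sum_(i < n) \sum_(j < n)
      christoffel c l i j (chart_map c (gamma s)) *
        velocity I gamma c s 0 i * V c s 0 j.

Definition cov_velocity (R : realType) (n : nat) (M : riemannian R n)
    (I : set R) (gamma : R -> M) (l : nat) : field_along M :=
  iter l (cov_derive I gamma) (velocity I gamma).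

Definition arclength (R : realType) (n : nat) (M : riemannian R n)
    (I : set R) (gamma : R -> M) : Prop :=
  forall c s, in_chart gamma I c s ->
    Num.sqrt (inner_along gamma (velocity I gamma) (velocity I gamma) c s) = 1.

Definition geodesic (R : realType) (n : nat) (M : riemannian R n)
    (I : set R) (gamma : R -> M) : Prop :=
  forall c s, in_chart gamma I c s -> cov_velocity I gamma 1 c s = 0.

(* The Euler-Lagrange equation of the r-energy in a space form of curvature K,
   for r >= 2. *)
Definition r_harmonic (R : realType) (n : nat) (M : riemannian R n) (K : R)
    (r : nat) (I : set R) (gamma : R -> M) : Prop :=
  let DT := cov_velocity I gamma in
  let ip := inner_along gamma in
  forall c s, in_chart gamma I c s ->
    0 = DT (2 * r - 1)%N c s +
        K *: \sum_(l < r.-1) (-1) ^+ l *: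
          (ip (DT 0%N) (DT l) c s *: DT (2 * r - 3 - l)%N c s
           - ip (DT 0%N) (DT (2 * r - 3 - l)%N) c s *: DT l c s).

Definition proper_r_harmonic (R : realType) (n : nat) (M : riemannian R n)
    (K : R) (r : nat) (I : set R) (gamma : R -> M) : Prop :=
  r_harmonic K r I gamma /\ ~ geodesic I gamma.

(* Frenet frame F 1, ..., F n of gamma with geodesic curvatures
   k 1, ..., k (n - 1); F i for i = 0 or i > n and k 0 are irrelevant.  When
   n = 1 the equation for F 1 reads D_T F_1 = 0 since k 1 = 0. *)
Record frenet_frame (R : realType) (n : nat) (M : riemannian R n)
    (I : set R) (gamma : R -> M) (F : nat -> field_along M)
    (k : nat -> R -> R) : Prop := FrenetFrame {
  frenet_smooth : forall i, (1 <= i <= n)%N -> smooth_field I gamma (F i);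
  frenet_orthonormal : forall i j, (1 <= i <= n)%N -> (1 <= j <= n)%N ->
    forall c s, in_chart gamma I c s ->
      inner_along gamma (F i) (F j) c s = (i == j)%:R;
  frenet_tangent : forall c s, in_chart gamma I c s ->
    F 1%N c s = velocity I gamma c s;
  frenet_first : forall c s, in_chart gamma I c s ->
    cov_derive I gamma (F 1%N) c s = k 1%N s *: F 2%N c s;
  frenet_middle : forall i, (2 <= i <= n - 1)%N ->
    forall c s, in_chart gamma I c s ->
      cov_derive I gamma (F i) c s =
        - k i.-1 s *: F i.-1 c s + k i s *: F i.+1 c s;
  frenet_last : (2 <= n)%N -> forall c s, in_chart gamma I c s ->
    cov_derive I gamma (F n) c s = - k n.-1 s *: F n.-1 c s;
  frenet_zero : forall j s, (n <= j)%N -> I s -> k j s = 0 }.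

(* Main.v *)
Require Import Defs.
From HB Require Import structures.
From mathcomp Require Import all_boot all_order all_algebra.
From mathcomp Require Import all_classical all_reals all_analysis.
From mathcomp Require Import ring zify.
Import Order.TTheory GRing.Theory Num.Theory.
Import numFieldNormedType.Exports.
Local Open Scope classical_set_scope.
Local Open Scope ring_scope.

(** In the Frenet frame of a curve with constant curvatures, [D_T] acts on
constant coefficient vectors by an antisymmetric tridiagonal matrix, so [D_T^l
T] has coefficients that are polynomials in the curvatures, and the r-harmonic
equation becomes a polynomial identity along each F_j. Its components along
F_2, F_4 and F_6 are plus or minus k_1 times the stated relations, and k_1 is
nonzero because the curve is not a geodesic. *)

(** * Derivatives relative to an interval *)

(** For another point e of I, the points s + u(e - s) with 0 < u < 1 lie in I by convexity, differ
    from s and tend to s with u. Properness makes the limit in [derive_within] unique. *)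
Lemma within_dnbhs_proper (R : realType) (I : set R) (s : R) :
  nondegenerate_interval I -> I s -> ProperFilter (within I (dnbhs s)).
Proof.
move=> [itvI [a [b [Ia Ib ab]]]] Is.
have [e [Ie es]] : exists e, I e /\ e != s.
  case: (eqVneq a s) => [as_|]; last by exists a.
  by exists b; split => //; rewrite -as_ gt_eqF.
apply: Build_ProperFilter_ex => P [d /= d0 Pd].
set f := fun u : R => s + u * (e - s).
have : f @ (0 : R) --> f 0.
  apply: (@cvgD _ _ _ (nbhs (0 : R)) _ (fun=> s) (fun u => u * (e - s))).
    exact: cvg_cst.
  by apply: cvgM; [exact: cvg_id | exact: cvg_cst].
rewrite /f mul0r addr0 => /cvgrPdist_lt /(_ _ d0) fd.
have : \forall u \near (0 : R)^'+, (`|s - f u| < d /\ 0 < u) /\ u < 1.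
  near=> u; split; last by near: u; exact: nbhs_right_lt.
  split; last by near: u; exact: nbhs_right_gt.
  by near: u; exact: cvg_within fd.
move=> near0; have [u [[ud u0] u1]] := @filter_ex _ _ (at_right_proper_filter (0 : R)) _ near0.
exists (f u); apply: Pd => //.
  by rewrite /f -subr_eq0 addrC addKr mulf_neq0 ?subr_eq0 // gt_eqF.
have fsu : f u - s = u * (e - s) by rewrite /f; ring.
have efu : e - f u = (1 - u) * (e - s) by rewrite /f; ring.
have u1' : 0 <= 1 - u by rewrite subr_ge0 ltW.
case: (ltgtP e s) es => // es _.
  apply: (itvI e s) => //; apply/andP; split.
    by rewrite -subr_le0 efu mulr_ge0_le0 // subr_le0 ltW.
  by rewrite -subr_le0 fsu mulr_ge0_le0 ?subr_le0 ?ltW.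
apply: (itvI s e) => //; apply/andP; split.
  by rewrite -subr_ge0 fsu mulr_ge0 ?subr_ge0 ?ltW.
by rewrite -subr_ge0 efu mulr_ge0 // subr_ge0 ltW.
Unshelve. all: by end_near. Qed.

Lemma derive_within_sum (R : realType) (V : normedModType R) (I : set R)
    (s : R) (n : nat) (a : nat -> R) (f : nat -> R -> V) (g : R -> V) :
  nondegenerate_interval I -> I s ->
  (forall i, (i < n)%N -> derivable_within I (f i) s) ->
  (\forall t \near within I (nbhs s), g t = \sum_(i < n) a i *: f i t) ->
  derive_within I g s = \sum_(i < n) a i *: derive_within I (f i) s.
Proof.
move=> hI Is df gE.
have PF := within_dnbhs_proper _ _ _ hI Is.
apply: cvg_lim; first exact: norm_hausdorff.
(* [gE] holds on the full neighbourhood filter, not the punctured one, so it also gives the value at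
   s, which enters the difference quotient. *)
have gs : g s = \sum_(i < n) a i *: f i s by exact: nbhs_singleton gE Is.
apply: (@cvg_trans _ ((fun t => \sum_(i < n) a i *: quotient_within (f i) s t)
   @ within I (dnbhs s))).
  apply: near_eq_cvg.
  have : \forall t \near within I (dnbhs s), g t = \sum_(i < n) a i *: f i t.
    by apply: (@filterS _ (nbhs s) _ _ _ _ gE) => t gt _; exact: gt.
  apply: filterS => t gt; rewrite /quotient_within gt gs -sumrB scaler_sumr.
  apply: eq_bigr => i _; rewrite -scalerBr !scalerA; congr (_ *: _).
  by rewrite mulrC.
apply: cvg_big; first exact: add_continuous.
move=> i _; exact: cvgZ (@cvg_cst _ (a i) _ _ _) (df i (ltn_ord i)).
Qed.

(** * Linearity of the covariant derivative along a curve *)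

Section CovariantDerivative.
Context {R : realType} {n : nat} {M : riemannian R n}.
Context {I : set R} {gamma : R -> M}.
Hypothesis hI : nondegenerate_interval I.
Hypothesis gammaC : {within I, continuous gamma}.

Lemma in_chart_near (c : chart M) (s : R) : in_chart gamma I c s ->
  \forall t \near within I (nbhs s), in_chart gamma I c t.
Proof.
move=> [Is cs].
have := ((subspace_continuousP _ _).1 gammaC) s Is (chart_dom c).
move=> /(_ (open_nbhs_nbhs (conj (@chart_dom_open _ _ M c) cs))).
rewrite /= /fmap /nbhs /= /within /=.
by apply: filterS => t h It; split => //; exact: h.
Qed.

(** The Christoffel term is V times a matrix independent of V, so its linearity becomes that of the
    matrix product. *)
Lemma cov_deriveE (V : field_along M) (c : chart M) (s : R) :
  cov_derive I gamma V c s = derive_within I (V c) s +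
    V c s *m \matrix_(j, l) (\sum_(i < n)
      christoffel c l i j (chart_map c (gamma s)) * velocity I gamma c s 0 i).
Proof.
congr (_ + _); apply/rowP => l; rewrite !mxE exchange_big.
apply: eq_bigr => j _; rewrite mxE mulr_sumr; apply: eq_bigr => i _.
by rewrite mulrC.
Qed.

(** The coefficients are constant, so no Leibniz term appears. The derivative sees only points near
    s, which [in_chart_near] keeps in the chart. *)
Lemma cov_derive_sum (a : nat -> R) (V : field_along M)
    (W : nat -> field_along M) (c : chart M) (s : R) :
  (forall i, (i < n)%N -> smooth_field I gamma (W i)) ->
  (forall t, in_chart gamma I c t -> V c t = \sum_(i < n) a i *: W i c t) ->
  in_chart gamma I c s ->
  cov_derive I gamma V c s = \sum_(i < n) a i *: cov_derive I gamma (W i) c s.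
Proof.
move=> sW VE cs; rewrite cov_deriveE (VE _ cs).
rewrite (@derive_within_sum _ _ _ _ n a (fun i => W i c)) //.
- rewrite mulmx_suml -big_split /=; apply: eq_bigr => i _.
  by rewrite cov_deriveE scalerDr scalemxAl.
- by case: cs.
- by move=> i /sW [h _]; exact: (h c 0%N).
- by apply: filterS (in_chart_near _ _ cs); exact: VE.
Qed.

End CovariantDerivative.

(** * Bilinearity of the metric *)

Section Inner.
Context {R : realType} {n : nat} {M : riemannian R n}.
Implicit Types (c : chart M) (x v w : 'rV[R]_n).

Lemma innerDl c x v1 v2 w : inner c x (v1 + v2) w = inner c x v1 w + inner c x v2 w.
Proof. by rewrite /inner !mulmxDl mxE. Qed.

Lemma innerZl c x a v w : inner c x (a *: v) w = a * inner c x v w.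
Proof. by rewrite /inner -!scalemxAl mxE. Qed.

Lemma innerZr c x a v w : inner c x v (a *: w) = a * inner c x v w.
Proof. by rewrite /inner linearZ -scalemxAr mxE. Qed.

Lemma inner_suml c x (J : finType) (v : J -> 'rV[R]_n) w :
  inner c x (\sum_j v j) w = \sum_j inner c x (v j) w.
Proof. by rewrite /inner !mulmx_suml summxE. Qed.

Lemma inner_sumr c x v (J : finType) (w : J -> 'rV[R]_n) :
  inner c x v (\sum_j w j) = \sum_j inner c x v (w j).
Proof. by rewrite /inner linear_sum mulmx_sumr summxE. Qed.

End Inner.

(* Indices are shifted: [a j] is the coefficient of F_(j+1), while [k j] is
   the curvature k_j. *)
Definition frenet_step {R : pzRingType} (k a : nat -> R) (j : nat) : R :=
  (if j is i.+1 then k j * a i else 0) - k j.+1 * a j.+1.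

Definition velocity_coef {R : pzRingType} (k : nat -> R) (l : nat) : nat -> R :=
  iter l (frenet_step k) (fun j => if j is 0%N then 1 else 0).

(** [frenet_step] is tridiagonal, so each derivative enlarges the support by at most one index:
    D_T^l T stays in the span of F_1, ..., F_(l+1). *)
Lemma velocity_coef_gt (R : pzRingType) (k : nat -> R) (l j : nat) :
  (l < j)%N -> velocity_coef k l j = 0.
Proof.
elim: l j => [|l IHl] [|j] //= lj.
by rewrite /frenet_step -/(velocity_coef k l) !IHl ?mulr0 ?subr0 //; do 2!apply: ltnW.
Qed.

(* Summation by parts; the boundary term is needed for the induction on m, and
   vanishes when m is the dimension of the manifold, since then k m = 0. *)
Lemma frenet_step_sum (R : comNzRingType) (p m : nat) (k a : nat -> R)
    (v : nat -> 'rV[R]_p) :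
  \sum_(i < m) a i *: ((if val i is i'.+1 then - k i *: v i' else 0)
                       + k i.+1 *: v i.+1) =
  \sum_(j < m) frenet_step k a j *: v j
  + (if m is m'.+1 then k m *: (a m *: v m' + a m' *: v m) else 0).
Proof.
elim: m => [|m IHm]; first by rewrite !big_ord0 addr0.
rewrite !big_ord_recr /= {}IHm -!addrA; congr (_ + _).
by case: m => [|m]; apply/rowP => j; rewrite /frenet_step !mxE; ring.
Qed.

(** * Iterated covariant derivatives of T in the Frenet frame *)

Section Frenet.
Context {R : realType} {n : nat} {M : riemannian R n}.
Context {I : set R} {gamma : R -> M}.
Hypothesis hI : nondegenerate_interval I.
Hypothesis gammaC : {within I, continuous gamma}.
Context {F : nat -> field_along M} {kappa : nat -> R -> R}.
Hypothesis hF : frenet_frame I gamma F kappa.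

Lemma cov_derive_frenet (c : chart M) (s : R) (i : nat) :
  in_chart gamma I c s -> (i < n)%N ->
  cov_derive I gamma (F i.+1) c s =
    (if i is i'.+1 then - kappa i s *: F i'.+1 c s else 0)
    + kappa i.+1 s *: F i.+2 c s.
Proof.
move=> cs; case: i => [|i] lin; first by rewrite (frenet_first hF) ?add0r.
move: (lin); rewrite leq_eqVlt => /orP[/eqP nE|lt_in].
  (* Last frame field: the term in F_(n+1), which is outside the frame, drops out because kappa_n =
     0. *)
  rewrite [kappa i.+2 s](frenet_zero hF) ?nE // ?scale0r ?addr0; last by case: cs.
  have n1 : n.-1 = i.+1 by move: nE; clear; lia.
  have n2 : (2 <= n)%N by move: nE; clear; lia.
  by rewrite (frenet_last hF) // n1.
by rewrite (frenet_middle hF) // ltnS /= leq_subRL ?add1n // (leq_trans _ lin).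
Qed.

Lemma cov_derive_frenet_sum (c : chart M) (s : R) (a : nat -> R)
    (V : field_along M) :
  (forall t, in_chart gamma I c t -> V c t = \sum_(i < n) a i *: F i.+1 c t) ->
  in_chart gamma I c s ->
  cov_derive I gamma V c s =
    \sum_(i < n) frenet_step (kappa ^~ s) a i *: F i.+1 c s.
Proof.
move=> VE cs.
rewrite (cov_derive_sum hI gammaC a _ (fun i => F i.+1) c) //; last first.
  by move=> i lin; apply: (frenet_smooth hF).
have := @frenet_step_sum _ _ n (kappa ^~ s) a (fun i => F i.+1 c s).
have boundary0 m : kappa m s = 0 -> (if m is m'.+1 then
    kappa m s *: (a m *: F m'.+1 c s + a m' *: F m.+1 c s) else 0) = 0.
  by case: m => // m ->; rewrite scale0r.
rewrite boundary0; last by apply: (frenet_zero hF) => //; case: cs.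
rewrite addr0 => <-; apply: eq_bigr => i _.
by rewrite cov_derive_frenet.
Qed.

Lemma inner_frenet (c : chart M) (s : R) (i j : nat) :
  in_chart gamma I c s -> (i < n)%N -> (j < n)%N ->
  inner c (chart_map c (gamma s)) (F i.+1 c s) (F j.+1 c s) = (i == j)%:R.
Proof. by move=> cs lin ljn; exact: (@frenet_orthonormal _ _ _ _ _ _ _ hF). Qed.

Lemma inner_frenet_sumr (c : chart M) (s : R) (a : nat -> R) (j : nat) :
  in_chart gamma I c s -> (j < n)%N ->
  inner c (chart_map c (gamma s)) (F j.+1 c s)
    (\sum_(i < n) a i *: F i.+1 c s) = a j.
Proof.
move=> cs jn; rewrite inner_sumr (bigD1 (Ordinal jn)) //= big1 => [|i ij].
  by rewrite innerZr inner_frenet // eqxx mulr1 addr0.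
rewrite innerZr inner_frenet //.
by move: ij; rewrite eq_sym -val_eqE /= => /negPf ->; rewrite mulr0.
Qed.

Lemma inner_frenet_suml (c : chart M) (s : R) (a : nat -> R) (j : nat) :
  in_chart gamma I c s -> (j < n)%N ->
  inner c (chart_map c (gamma s)) (\sum_(i < n) a i *: F i.+1 c s)
    (F j.+1 c s) = a j.
Proof.
move=> cs jn; rewrite inner_suml (bigD1 (Ordinal jn)) //= big1 => [|i ij].
  by rewrite innerZl inner_frenet // eqxx mulr1 addr0.
rewrite innerZl inner_frenet //.
by move: ij; rewrite -val_eqE /= => /negPf ->; rewrite mulr0.
Qed.

Section ConstantCurvatures.
Context {p : nat} {k : nat -> R}.
Hypothesis hk : forall i, (1 <= i <= p)%N -> forall s, I s -> kappa i s = k i.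
Hypothesis n_gt0 : (0 < n)%N.

Lemma cov_velocity_frenet (l : nat) (c : chart M) (s : R) :
  (l <= p)%N -> in_chart gamma I c s ->
  cov_velocity I gamma l c s = \sum_(i < n) velocity_coef k l i *: F i.+1 c s.
Proof.
(* The point s is generalised: the next derivative needs the expansion at all points of the curve in
   the chart. *)
elim: l s => [|l IHl] s lp cs.
  have -> : cov_velocity I gamma 0 c s = F 1%N c s by rewrite (frenet_tangent hF).
  rewrite (bigD1 (Ordinal n_gt0)) //= scale1r big1.
    by rewrite addr0.
  by case=> [[|i] lin] //=; rewrite scale0r.
have Is : I s by case: cs.
rewrite /cov_velocity iterS (cov_derive_frenet_sum c s (velocity_coef k l)) //.
  apply: eq_bigr => i _; congr (_ *: _); rewrite /frenet_step /=.
  (* For j + 1 > l the curvature may fail to be constant, but the coefficient it multiplies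
     vanishes. *)
  have kE j : kappa j.+1 s * velocity_coef k l j.+1 =
              k j.+1 * velocity_coef k l j.+1.
    case: (leqP j.+1 l) => [jl|lj]; last by rewrite velocity_coef_gt ?mulr0.
    by rewrite hk //= (leq_trans jl) // ltnW.
  rewrite kE; case: (val i) => // j; congr (_ - _).
  case: (leqP j l) => [jl|lj]; last by rewrite velocity_coef_gt ?mulr0.
  by rewrite hk //= (leq_trans _ lp).
by move=> t ct; apply: IHl => //; exact: ltnW.
Qed.

(* [D_T^(p+1) T] may involve the nonconstant curvature of order p + 1, but not
   in its components along F_1, ..., F_p. *)
Lemma cov_velocity_frenet_last (j : nat) (c : chart M) (s : R) :
  (j < p)%N -> (j < n)%N -> in_chart gamma I c s ->
  inner c (chart_map c (gamma s)) (cov_velocity I gamma p.+1 c s) (F j.+1 c s) =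
    velocity_coef k p.+1 j.
Proof.
move=> jp jn cs; have Is : I s by case: cs.
rewrite /cov_velocity iterS (cov_derive_frenet_sum c s (velocity_coef k p)) //.
  rewrite inner_frenet_suml //= /frenet_step; case: j jp jn => [|j] jp jn.
    by rewrite hk.
  by rewrite hk ?(ltnW jp) // hk.
by move=> t ct; exact: cov_velocity_frenet.
Qed.

End ConstantCurvatures.

(** With p = 2r - 2, only the leading term D_T^(2r-1) T has order p + 1 and calls for
    [cov_velocity_frenet_last], whence the bound on j; all other orders are at most 2r - 3. *)
Lemma r_harmonic_coord (K : R) (r j : nat) (k : nat -> R) (c : chart M) (s : R) :
  (2 <= r)%N -> r_harmonic K r I gamma ->
  (forall i, (1 <= i <= 2 * r - 2)%N -> forall s, I s -> kappa i s = k i) ->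
  (j < 2 * r - 2)%N -> (j < n)%N -> in_chart gamma I c s ->
  let a := velocity_coef k in
  0 = a (2 * r - 1)%N j + K * \sum_(l < r.-1) (-1) ^+ l *
        (a l 0%N * a (2 * r - 3 - l)%N j - a (2 * r - 3 - l)%N 0%N * a l j).
Proof.
move=> r2 harm hk jp jn cs a.
have n_gt0 : (0 < n)%N by exact: leq_trans jn.
have DTE l : (l <= 2 * r - 2)%N -> cov_velocity I gamma l c s =
    \sum_(i < n) a l i *: F i.+1 c s.
  by move=> lp; exact: (cov_velocity_frenet hk).
have DTj l : (l <= 2 * r - 2)%N ->
    inner c (chart_map c (gamma s)) (cov_velocity I gamma l c s) (F j.+1 c s) = a l j.
  by move=> lp; rewrite DTE // inner_frenet_suml.
have T0 l : (l <= 2 * r - 2)%N -> inner_along gamma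
    (cov_velocity I gamma 0) (cov_velocity I gamma l) c s = a l 0%N.
  move=> lp; rewrite /inner_along -[cov_velocity I gamma 0 c s](frenet_tangent hF cs).
  by rewrite DTE // inner_frenet_sumr.
have := congr1 (fun v => inner c (chart_map c (gamma s)) v (F j.+1 c s)) (harm c s cs).
(* Writing the zero vector as a zero multiple lets [innerZl] evaluate its inner product. *)
rewrite -{1}(scale0r (0 : 'rV[R]_n)) innerZl mul0r innerDl innerZl inner_suml => E.
rewrite [LHS]E.
have -> : (2 * r - 1 = (2 * r - 2).+1)%N by move: r2; clear; lia.
rewrite (cov_velocity_frenet_last hk) //; congr (_ + _ * _).
apply: eq_bigr => l _; have lr := ltn_ord l.
have lp : (l <= 2 * r - 2)%N by move: lr r2; clear; lia.
have lp' : (2 * r - 3 - l <= 2 * r - 2)%N by move: lr r2; clear; lia.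
by rewrite innerZl innerDl -scaleNr !innerZl !T0 // !DTj // mulNr.
Qed.

End Frenet.

(** * The polynomial relations between the curvatures *)

Theorem theorem1p5 (R : realType) (n : nat) (M : riemannian R n) (K : R)
    (hM : space_form M K)
    (I : set R) (hI : nondegenerate_interval I)
    (r : nat) (hr : r = 3%N \/ r = 4%N)
    (gamma : R -> M) (hsmooth : smooth_curve I gamma)
    (hharm : proper_r_harmonic K r I gamma)
    (harc : arclength I gamma)
    (F : nat -> field_along M) (kappa : nat -> R -> R)
    (hF : frenet_frame I gamma F kappa)
    (k : nat -> R)
    (hk : forall i, (1 <= i <= 2 * r - 2)%N -> forall s, I s ->
            kappa i s = k i) :
  (r = 3%N ->
     (k 1%N ^+ 2 + k 2%N ^+ 2) ^+ 2 + k 2%N ^+ 2 * k 3%N ^+ 2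
       = K * (2 * k 1%N ^+ 2 + k 2%N ^+ 2)
     /\
     k 2%N * k 3%N * (k 1%N ^+ 2 + k 2%N ^+ 2 + k 3%N ^+ 2 + k 4%N ^+ 2)
       = k 2%N * k 3%N * K)
  /\
  (r = 4%N ->
     [/\ (k 1%N ^+ 2 + k 2%N ^+ 2) ^+ 3
         + k 2%N ^+ 2 * k 3%N ^+ 2
           * (2 * k 1%N ^+ 2 + 2 * k 2%N ^+ 2 + k 3%N ^+ 2 + k 4%N ^+ 2)
         = K * ((k 1%N ^+ 2 + k 2%N ^+ 2) ^+ 2 + k 2%N ^+ 2 * k 3%N ^+ 2)
           + 2 * K * k 1%N ^+ 2 * (k 1%N ^+ 2 + k 2%N ^+ 2),
         k 2%N * k 3%N
           * ((k 1%N ^+ 2 + k 2%N ^+ 2) ^+ 2 + (k 3%N ^+ 2 + k 4%N ^+ 2) ^+ 2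
              + k 1%N ^+ 2 * k 3%N ^+ 2 + 2 * k 2%N ^+ 2 * k 3%N ^+ 2
              + k 4%N ^+ 2 * (k 1%N ^+ 2 + k 2%N ^+ 2 + k 5%N ^+ 2))
         = k 2%N * k 3%N * K * (2 * k 1%N ^+ 2 + k 2%N ^+ 2 + k 3%N ^+ 2 + k 4%N ^+ 2)
       & k 2%N * k 3%N * k 4%N * k 5%N
           * (k 1%N ^+ 2 + k 2%N ^+ 2 + k 3%N ^+ 2 + k 4%N ^+ 2 + k 5%N ^+ 2 + k 6%N ^+ 2)
         = k 2%N * k 3%N * k 4%N * k 5%N * K]).
Proof.
(* The relations are between constants, so they are read off at one point s, chosen with D_T T
   nonzero. *)
have [hrh /existsNP [c /existsNP [s /not_implyP [cs DT1]]]] := hharm.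
have Is : I s by case: cs.
have gammaC : {within I, continuous gamma} by case: hsmooth.
(* A nonzero k_j guarantees that F_(j+1) belongs to the frame, so that the equation can be projected
   onto it. *)
have k_ge j : (1 <= j <= 2 * r - 2)%N -> k j != 0 -> (j < n)%N.
  move=> jr; apply: contraNT; rewrite -leqNgt => nj.
  by rewrite -(hk _ jr s Is) (frenet_zero hF).
have k_gt0 : (0 < 2 * r - 2)%N by case: hr => ->.
have k1 : k 1%N != 0.
  apply/eqP => k10; apply: DT1.
  case: (posnP n) => [n0|n_gt0].
    by move: (cov_velocity _ _ _ _ _); rewrite n0 => v; exact: thinmx0.
  rewrite (cov_velocity_frenet hI gammaC hF hk) // big1 // => i _.
  by case: (val i) => [|[|?]]; rewrite /= /frenet_step /= ?k10 !(mul0r, mulr0) subrr scale0r.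
have r2 : (2 <= r)%N by case: hr => ->.
have coord j (jr : (j < 2 * r - 2)%N) (jn : (j < n)%N) :=
  r_harmonic_coord hI gammaC hF _ _ _ _ _ _ r2 hrh hk jr jn cs.
have n1 : (1 < n)%N by apply: k_ge.
(* [frenet_step] switches the parity of indices, so only F_2, F_4, ... give nontrivial components.
   Along F_(2m) the leading term has sign (-1)^(r-m); [esym] absorbs the minus sign. *)
split=> r_eq; subst r.
  split.
    apply: (mulfI k1); apply/subr0_eq; rewrite [RHS](coord 1%N) //.
    by rewrite !big_ord_recr big_ord0 /velocity_coef /= /frenet_step /=; ring.
  (* For k_3 = 0 the relation reads 0 = 0; otherwise n > 3 and F_4 is available. The later splits on
     k_3 and k_5 work alike. *)
  have [k30|k3] := eqVneq (k 3%N) 0; first by rewrite k30; ring.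
  apply: (mulfI k1); apply/esym/subr0_eq; rewrite [RHS](coord 3%N) ?k_ge //.
  by rewrite !big_ord_recr big_ord0 /velocity_coef /= /frenet_step /=; ring.
split.
- apply: (mulfI k1); apply/esym/subr0_eq; rewrite [RHS](coord 1%N) //.
  by rewrite !big_ord_recr big_ord0 /velocity_coef /= /frenet_step /=; ring.
- have [k30|k3] := eqVneq (k 3%N) 0; first by rewrite k30; ring.
  apply: (mulfI k1); apply/subr0_eq; rewrite [RHS](coord 3%N) ?k_ge //.
  by rewrite !big_ord_recr big_ord0 /velocity_coef /= /frenet_step /=; ring.
have [k50|k5] := eqVneq (k 5%N) 0; first by rewrite k50; ring.
apply: (mulfI k1); apply/esym/subr0_eq; rewrite [RHS](coord 5%N) ?k_ge //.
by rewrite !big_ord_recr big_ord0 /velocity_coef /= /frenet_step /=; ring.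
Qed.
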